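(* Let $\beta>0$. Let $X_T$ be the value at time $T$ of the solution of an SDE and, for each step size $\Delta>0$, let $X_T^{\Delta}$ denote the value at time $T$ of a time-discrete approximation with time step $\Delta$, where $X_T$ and all the $X_T^{\Delta}$ are constructed from the same Wiener process. Then the following are equivalent: (i) there is a constant $K$, independent of $\Delta$, such that $\left|E(X_T)-E(X_T^{\Delta})\right|<K\Delta^{\beta}$ for all $\Delta>0$; (ii) the discretization is weakly convergent, i.e. $\lim_{\Delta\to0}\left|E(X_T)-E(X_T^{\Delta})\right|=0$, and for all $k>1$ there is a positive constant $K_1$, independent of $\Delta$, such that $\left|E(X_T^{\Delta})-E(X_T^{\Delta/k})\right|<K_1\Delta^{\beta}$ for all $\Delta>0$, where $X_T^{\Delta/k}$ is the approximation with time step $\Delta/k$ built from the same Wiener process.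
   Context: $X_T$ and $X_T^{\Delta}$ ($\Delta>0$) are real-valued integrable random variables on one common probability space. Only the family $(X_T^{\Delta})_{\Delta>0}$ and $X_T$ enter the statement; no particular discretization scheme or SDE is assumed. The constant $K_1$ may depend on $k$. *)

(* Defs.v *)
From HB Require Import structures.
From mathcomp Require Export all_boot all_order all_algebra.
From mathcomp Require Export all_classical all_reals all_analysis.
Export Order.TTheory GRing.Theory Num.Theory.
Export numFieldNormedType.Exports.

Set Implicit Arguments.
Unset Strict Implicit.
Unset Printing Implicit Defensive.

Local Open Scope classical_set_scope.
Local Open Scope ring_scope.

(* In these definitions [XD D] is the approximation with step size [D]; the
   family is total on [R], but only its values at [D > 0] are ever used. *)

Definition weak_order d (T : measurableType d) (R : realType)
    (P : probability T R) (beta : R)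
    (X : {RV P >-> R}) (XD : R -> {RV P >-> R}) : Prop :=
  exists K : R, forall D : R, 0 < D ->
    (`| 'E_P[X] - 'E_P[XD D] | < (K * D `^ beta)%:E)%E.

Definition weakly_convergent d (T : measurableType d) (R : realType)
    (P : probability T R) (X : {RV P >-> R}) (XD : R -> {RV P >-> R}) : Prop :=
  (`| 'E_P[X] - 'E_P[XD D] |)%E @[D --> 0^'+] --> 0%E.

Definition weak_refinement_bound d (T : measurableType d) (R : realType)
    (P : probability T R) (beta : R) (XD : R -> {RV P >-> R}) : Prop :=
  forall k : R, 1 < k -> exists2 K1 : R, 0 < K1 & forall D : R, 0 < D ->
    (`| 'E_P[XD D] - 'E_P[XD (D / k)%R] | < (K1 * D `^ beta)%:E)%E.

(* Main.v *)
(* Iterating the refinement bound along [D], [D / 2], [D / 4], ... bounds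
   [`|E(X^D) - E(X^(D / 2^n))|] by a geometric series of ratio [2^(- beta)],
   uniformly in [n]; weak convergence then lets [n] tend to infinity.  The
   converse is the triangle inequality. *)
Require Import Defs.
From mathcomp Require Import ring lra.

Local Open Scope classical_set_scope.
Local Open Scope ring_scope.

Section real_function.
Context {R : realType} {beta : R} (beta_gt0 : 0 < beta).
Implicit Types (a C D : R) (b : R -> R).

(** An absolute value is nonnegative and [D ^ beta] is positive, so a strict bound forces the sign
    of the constant, which [weak_order] leaves open. *)
Lemma power_bound_pos {C D x : R} : 0 < D -> `|x| < C * D `^ beta -> 0 < C.
Proof.
move=> D0 h; rewrite -(pmulr_lgt0 _ (powR_gt0 beta D0)).
exact: le_lt_trans (normr_ge0 _) h.
Qed.

Lemma power_bound_cvg {a b C} :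
    (forall D, 0 < D -> `|a - b D| < C * D `^ beta) ->
  b D @[D --> 0^'+] --> a.
Proof.
move=> hC; apply/subr_cvg0/norm_cvg0P.
apply: (@squeeze_cvgr _ _ _ _ (cst 0) (fun D => C * D `^ beta)).
- near=> D; rewrite normr_ge0 /= distrC ltW// hC//.
- exact: cvg_cst.
- by rewrite -[X in _ --> X](mulr0 C); apply: cvgMr; exact: powR_cvg0.
Unshelve. all: by end_near. Qed.

(** Triangle inequality through [a]: since [k > 1] and [beta > 0], both errors are below
    [C * D ^ beta]. *)
Lemma power_bound_refinement {a b C k D} :
    (forall D, 0 < D -> `|a - b D| < C * D `^ beta) -> 1 < k -> 0 < D ->
  `|b D - b (D / k)| < 2 * C * D `^ beta.
Proof.
move=> hC k1 D0; have k0 : 0 < k by exact: lt_trans k1.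
have Dk0 : 0 < D / k by rewrite divr_gt0.
have C0 := power_bound_pos D0 (hC _ D0).
have le_pow : C * (D / k) `^ beta <= C * D `^ beta.
  rewrite ler_pM2l// ge0_ler_powR ?nnegrE ?(ltW beta_gt0) ?(ltW Dk0) ?ltW//.
  by rewrite ltr_pdivrMr// ltr_pMr.
have := ler_distD a (b D) (b (D / k)); rewrite (distrC (b D) a).
by have := hC _ D0; have := hC _ Dk0; lra.
Qed.

(* The constant solves [K + C * 2^(- beta) = C]. *)
Lemma dyadic_refinement_bound {b K} :
    (forall D, 0 < D -> `|b D - b (D / 2)| < K * D `^ beta) ->
  forall n D, 0 < D ->
    `|b D - b (D / 2 ^+ n)| <= K / (1 - 2^-1 `^ beta) * D `^ beta.
Proof.
move=> hK; set r := 2^-1 `^ beta; set C := K / (1 - r).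
have r1 : r < 1.
  have <- : 1 `^ beta = 1 by rewrite powR1.
  by rewrite gt0_ltr_powR ?nnegrE ?invr_ge0// invf_lt1// ltr1n.
have C0 : 0 <= C.
  rewrite divr_ge0 ?subr_ge0 ?(ltW r1)//.
  exact: ltW (power_bound_pos ltr01 (hK _ ltr01)).
have KC : K + C * r = C by rewrite /C; field; lra.
elim=> [|n IHn] D D0.
  by rewrite expr0 divr1 subrr normr0 mulr_ge0 ?powR_ge0.
have D20 : 0 < D / 2 by rewrite divr_gt0.
(* The hypothesis is used at [D / 2]: halving this [n] times gives [D / 2 ^ n.+1], and the bound
   picks up the factor [r]. *)
have := IHn _ D20; rewrite -mulrA -invfM -exprS powRM ?invr_ge0 ?(ltW D0)//.
rewrite -/r => IH.
apply: le_trans (ler_distD (b (D / 2)) _ _) _.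
rewrite -KC mulrDl; apply: lerD; first exact: ltW (hK _ D0).
by rewrite -mulrA [r * _]mulrC.
Qed.

Lemma refinement_power_bound {a b K} : b D @[D --> 0^'+] --> a ->
    (forall D, 0 < D -> `|b D - b (D / 2)| < K * D `^ beta) ->
  exists C, forall D, 0 < D -> `|a - b D| < C * D `^ beta.
Proof.
move=> /cvgrPdist_lt ba /dyadic_refinement_bound.
(* Passing to the limit yields only a weak inequality with [C]; the extra 1 makes it strict. *)
set C := K / _ => hC; exists (C + 1) => D D0.
apply: (@le_lt_trans _ _ (C * D `^ beta)); last first.
  by rewrite ltr_pM2r ?powR_gt0// ltrDl.
apply/ler_addgt0Pl => e /ba[d d0 near0].
(* With this [n], the step [D / 2 ^ n] lies within [d] of 0, where [b] is [e]-close to [a]. *)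
have [n Dn] : exists n, D / d < 2 ^+ n.
  by exists (Num.Def.archi_bound (D / d)); exact: upper_nthrootP.
have Dn0 : 0 < D / 2 ^+ n by rewrite divr_gt0// exprn_gt0.
apply: le_trans (ler_distD (b (D / 2 ^+ n)) _ _) _.
rewrite (distrC (b (D / 2 ^+ n))); apply: lerD (hC _ _ D0).
apply/ltW/near0 => //=; rewrite sub0r normrN gtr0_norm//.
by rewrite ltr_pdivrMr ?exprn_gt0// mulrC -ltr_pdivrMr.
Qed.

End real_function.

Theorem theorem2p2 (d : measure_display) (T : measurableType d) (R : realType)
    (P : probability T R) (beta : R) (beta_gt0 : 0 < beta)
    (X : {RV P >-> R}) (XD : R -> {RV P >-> R})
    (X_integrable : P.-integrable [set: T] (EFin \o X))
    (XD_integrable : forall D : R, 0 < D ->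
       P.-integrable [set: T] (EFin \o XD D)) :
  weak_order beta X XD <->
  (weakly_convergent X XD /\ weak_refinement_bound beta XD).
Proof.
rewrite /weak_order /weakly_convergent /weak_refinement_bound.
have /Lfun1_integrable/expectation_fin_num/fineK := X_integrable.
set a := fine _ => aE.
(* Integrability makes the expectations finite for [D > 0], which reduces the theorem to the real
   function [b]. *)
pose b D := fine 'E_P[XD D].
have bE D : 0 < D -> 'E_P[XD D]%E = (b D)%:E.
  move=> D0; rewrite fineK//.
  exact/expectation_fin_num/Lfun1_integrable/XD_integrable.
have abE D : 0 < D -> (`|'E_P[X] - 'E_P[XD D]|)%E = `|a - b D|%:E.
  by move=> D0; rewrite -aE bE.
have bbE k D : 0 < k -> 0 < D ->
    (`|'E_P[XD D] - 'E_P[XD (D / k)%R]|)%E = `|b D - b (D / k)|%:E.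
  by move=> k0 D0; rewrite !bE// divr_gt0.
have cvgE : (`|'E_P[X] - 'E_P[XD D]|)%E @[D --> 0^'+] --> 0%E <->
    b D @[D --> 0^'+] --> a.
  (* The two error functions are known to agree for [D > 0], which holds eventually at [0^'+]. *)
  have near_fE : {near 0^'+, (fun D => `|'E_P[X] - 'E_P[XD D]|)%E
      =1 EFin \o (fun D => `|b D - a|)}.
    by near=> D; rewrite abE//= distrC.
  split=> [f0|/subr_cvg0/(iffRL (norm_cvg0P _)) ba0].
    have /fine_cvg : EFin \o (fun D => `|b D - a|) @ 0^'+ --> 0%E.
      by apply: cvg_trans f0; exact: near_eq_cvg near_fE.
    by move=> ?; exact/subr_cvg0/norm_cvg0P.
  have : EFin \o (fun D => `|b D - a|) @ 0^'+ --> 0%E.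
    by apply: cvg_EFin ba0; exact: nearW.
  apply: cvg_trans; apply: near_eq_cvg.
  by near=> D; apply/esym; near: D.
split.
- move=> [C hC]; have {}hC D : 0 < D -> `|a - b D| < C * D `^ beta.
    by move=> D0; rewrite -lte_fin -abE// hC.
  split; first exact/cvgE/(power_bound_cvg beta_gt0 hC).
  move=> k k1; exists (2 * C).
    by rewrite mulr_gt0// (power_bound_pos ltr01 (hC _ ltr01)).
  move=> D D0; rewrite bbE ?(lt_trans _ k1)// lte_fin.
  exact: power_bound_refinement hC k1 D0.
(* The refinement bound is taken at [k = 2], the ratio of the dyadic iteration. *)
- move=> [/cvgE ba /(_ 2)]; rewrite ltr1n => /(_ isT)[K _ hK].
  have {}hK D : 0 < D -> `|b D - b (D / 2)| < K * D `^ beta.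
    by move=> D0; rewrite -lte_fin -bbE// hK.
  have [C hC] := refinement_power_bound beta_gt0 ba hK.
  by exists C => D D0; rewrite abE// lte_fin hC.
Unshelve. all: by end_near. Qed.
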